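(* Let $d\in\mathbb{N}$ and let $F_{d,r}$ be the weighted Wiener-type space defined in the context. (i) If $r(\boldsymbol{k})=1$ for all $\boldsymbol{k}\in\mathbb{Z}^d$, then for every $n,d\geq 1$, \[\inf_{Q_{d,n}} e^{\mathrm{wor}}(F_{d,r},Q_{d,n})=\frac12,\] where the infimum is over all linear algorithms $Q_{d,n}$ using $n$ points. Consequently $n^{\mathrm{wor}}(\varepsilon,d,F_{d,r})$ is unbounded (no finite $n$ suffices) for every $\varepsilon\in(0,1/2)$. (ii) If $r=r_0$, where $r_0(\boldsymbol{k})=\max\left(1,\log\log\min_{j\in\operatorname{supp}(\boldsymbol{k})}|k_j|\right)$ for $\boldsymbol{k}\neq\boldsymbol{0}$ and $r_0(\boldsymbol{0})=1$, then the information complexity $n^{\mathrm{wor}}(\varepsilon,d,F_{d,r_0})$ grows at least exponentially fast in $\varepsilon^{-1}$: there exist constants $c,a>0$ such that $n^{\mathrm{wor}}(\varepsilon,d,F_{d,r_0})\geq c\exp(a\varepsilon^{-1})$ for all $d\in\mathbb{N}$ and $\varepsilon\in(0,1)$.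
   Context: For a weight function $r:\mathbb{Z}^d\to[1,\infty)$, let \[F_{d,r}=\Big\{f\in C([0,1)^d)\ \text{real-valued}:\ \|f\|:=\sum_{\boldsymbol{k}\in\mathbb{Z}^d}|\hat f(\boldsymbol{k})|\,r(\boldsymbol{k})<\infty\Big\},\qquad \hat f(\boldsymbol{k})=\int_{[0,1)^d}f(\boldsymbol{x})e^{-2\pi\mathrm{i}\boldsymbol{k}\cdot\boldsymbol{x}}\,\mathrm{d}\boldsymbol{x}.\] Let $I_d(f)=\int_{[0,1)^d}f(\boldsymbol{x})\,\mathrm{d}\boldsymbol{x}$. A linear algorithm using $n$ points is $Q_{d,n}(f)=\sum_{h=0}^{n-1}c_hf(\boldsymbol{x}_h)$ with points $\boldsymbol{x}_h\in[0,1)^d$ and real coefficients $c_h$. Its worst-case error is $e^{\mathrm{wor}}(F_{d,r},Q_{d,n})=\sup_{f\in F_{d,r},\|f\|\leq1}|I_d(f)-Q_{d,n}(f)|$, and the information complexity is $n^{\mathrm{wor}}(\varepsilon,d,F_{d,r})=\min\{n\in\mathbb{N}:\exists Q_{d,n}\text{ with }e^{\mathrm{wor}}(F_{d,r},Q_{d,n})\leq\varepsilon\}$. For $\boldsymbol{k}\in\mathbb{Z}^d$, $\operatorname{supp}(\boldsymbol{k})=\{j:k_j\neq0\}$; $\log$ is the natural logarithm, with $\log 0=-\infty$. *)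

(* Defs.v *)
From HB Require Import structures.
From mathcomp Require Import all_boot all_order all_algebra.
From mathcomp Require Import all_classical all_reals all_analysis.
From mathcomp Require Import complex.

Set Implicit Arguments.
Unset Strict Implicit.
Unset Printing Implicit Defensive.

Import Order.TTheory GRing.Theory Num.Theory.
Import numFieldNormedType.Exports.

Local Open Scope classical_set_scope.
Local Open Scope ring_scope.

Section lebesgue_tuple.
Variable R : realType.
Let T := measurableTypeR R.

Definition tcons d (p : T * d.-tuple T) : d.+1.-tuple T := [tuple of p.1 :: p.2].

Lemma measurable_tcons d : measurable_fun setT (@tcons d).
Proof. by apply: measurable_cons; [exact: measurable_fst|exact: measurable_snd]. Qed.

Section step.
Variables (d : nat) (m : {sigma_finite_measure set (d.-tuple T) -> \bar R}).

Definition lebesgue_tuple_step : set (d.+1.-tuple T) -> \bar R :=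
  pushforward (@lebesgue_measure R \x m)%E (@tcons d).

Let mtcons := @measurable_tcons d.

Let step0 : lebesgue_tuple_step set0 = 0%E.
Proof. exact: measure0. Qed.

Let step_ge0 A : (0 <= lebesgue_tuple_step A)%E.
Proof. exact: measure_ge0. Qed.

Let step_sigma_additive : semi_sigma_additive lebesgue_tuple_step.
Proof. exact: measure_semi_sigma_additive. Qed.

HB.instance Definition _ := isMeasure.Build _ _ _ lebesgue_tuple_step
  step0 step_ge0 step_sigma_additive.

Let step_sigma_finite : sigma_finite setT lebesgue_tuple_step.
Proof.
have /sigma_finiteP[F [FT ndF Foo]] := sigma_finiteT (@lebesgue_measure R).
have /sigma_finiteP[G [GT ndG Goo]] := sigma_finiteT m.
pose u (t : d.+1.-tuple T) : T * d.-tuple T := (thead t, [tuple of behead t]).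
have Ku : cancel (@tcons d) u by move=> [x t]; congr pair; exact: val_inj.
have mu : measurable_fun setT u.
  apply: (@measurable_fun_pair _ _ _ _ _ _ (fun t : d.+1.-tuple T => thead t)
    (fun t : d.+1.-tuple T => [tuple of behead t])).
    exact: measurable_tnth.
  exact: measurable_behead.
exists (fun n => u @^-1` (F n `*` G n)).
  rewrite -preimage_bigcup (_ : \bigcup_n _ = setT) ?preimage_setT//.
  rewrite -subTset => -[x t] _.
  have [k _ Fk] : (\bigcup_n F n) x by rewrite -FT.
  have [l _ Gl] : (\bigcup_n G n) t by rewrite -GT.
  exists (maxn k l) => //; split.
  - by move: x Fk; exact/subsetPset/ndF/leq_maxl.
  - by move: t Gl; exact/subsetPset/ndG/leq_maxr.
move=> n; have [mF Fn] := Foo n; have [mG Gn] := Goo n; split.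
  by rewrite -[X in measurable X]setTI; apply: mu => //; exact: measurableX.
rewrite /lebesgue_tuple_step /pushforward (_ : _ @^-1` _ = F n `*` G n).
  by rewrite product_measure1E// lte_mul_pinfty// ge0_fin_numE.
by apply/seteqP; split=> p; rewrite /preimage /mkset Ku.
Qed.

HB.instance Definition _ :=
  Measure_isSigmaFinite.Build _ _ _ lebesgue_tuple_step step_sigma_finite.

End step.

(* Lebesgue measure on R^d: R^0 is a point of mass 1, and R^(d+1) is identified
   with R * R^d by tcons. *)
Fixpoint lebesgue_tuple d : {sigma_finite_measure set (d.-tuple T) -> \bar R} :=
  if d is d'.+1 then lebesgue_tuple_step (lebesgue_tuple d')
  else \d_([tuple] : 0.-tuple T).

Lemma lebesgue_tuple_box d (A : 'I_d -> set T) :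
  (forall i, measurable (A i)) ->
  lebesgue_tuple d [set t | forall i, A i (tnth t i)] =
  (\prod_(i < d) lebesgue_measure (A i))%E.
Proof.
elim: d A => [|d IHd] A mA /=.
  by rewrite big_ord0 diracE mem_set// => -[].
rewrite big_ord_recl -IHd// -product_measure1E//; last first.
  rewrite (_ : mkset _ = \bigcap_(i in [set: 'I_d])
      ((fun t : d.-tuple T => tnth t i) @^-1` A (lift ord0 i))); last first.
    by apply/seteqP; split=> t h i => [_|]; exact: h.
  apply: fin_bigcap_measurable => // i _.
  by rewrite -[X in measurable X]setTI; exact: measurable_tnth.
rewrite /= /lebesgue_tuple_step /pushforward; congr (_ _).
apply/seteqP; split=> -[x t] /=.
  move=> h; split; first exact: (h ord0).
  by move=> i; have := h (lift ord0 i); rewrite /tcons tnthS.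
move=> [hx ht] i; case: (unliftP ord0 i) => [j ->|->]//.
by rewrite tnthS; exact: ht.
Qed.

End lebesgue_tuple.

Section wiener.
Variable R : realType.

Definition cube d : set 'rV[R]_d := [set x | forall i, 0 <= x ord0 i < 1].

Definition row_of d (t : d.-tuple (measurableTypeR R)) : 'rV[R]_d :=
  \row_i tnth t i.

(* The topology used below lives on 'rV[R]_d and the product sigma-algebra on
   d.-tuple R; row_of is the identification of the two. *)
Definition cube_integrable d (g : 'rV[R]_d -> R) : Prop :=
  (lebesgue_tuple R d).-integrable (@row_of d @^-1` @cube d)
    (fun t => (g (row_of t))%:E).

Definition cube_int d (g : 'rV[R]_d -> R) : R :=
  \int[lebesgue_tuple R d]_(t in @row_of d @^-1` @cube d) g (row_of t).

Definition cube_intC d (g : 'rV[R]_d -> R[i]) : R[i] :=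
  (cube_int (fun x => complex.Re (g x)) +i*
   cube_int (fun x => complex.Im (g x)))%C.

Definition expi (t : R) : R[i] := (cos t +i* sin t)%C.

Definition dotZ d (k : 'rV[int]_d) (x : 'rV[R]_d) : R :=
  \sum_(i < d) (k ord0 i)%:~R * x ord0 i.

Definition fourier d (f : 'rV[R]_d -> R) (k : 'rV[int]_d) : R[i] :=
  cube_intC (fun x => (f x)%:C%C * expi (- (2 * pi * dotZ k x))).

Definition wnorm d (r : 'rV[int]_d -> R) (f : 'rV[R]_d -> R) : \bar R :=
  \esum_(k in [set: 'rV[int]_d]) (Normc.normc (fourier f k) * r k)%:E.

(* A function on [0,1)^d is represented by a total function whose values off
   the cube are never used. Continuity on the half-open cube does not imply
   integrability, without which the Fourier coefficients are undefined. *)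
Definition wiener d (r : 'rV[int]_d -> R) : set ('rV[R]_d -> R) :=
  [set f | [/\ {within @cube d, continuous f}, cube_integrable f
             & (wnorm r f < +oo)%E]].

Record algorithm d n := Algorithm {
  points : 'I_n -> 'rV[R]_d;
  coefs : 'I_n -> R;
  points_cube : forall h, cube (points h)
}.

Definition apply_alg d n (Q : algorithm d n) (f : 'rV[R]_d -> R) : R :=
  \sum_(h < n) coefs Q h * f (points Q h).

Definition worst_case_error d (r : 'rV[int]_d -> R) n (Q : algorithm d n) :
    \bar R :=
  ereal_sup [set (`|cube_int f - apply_alg Q f|)%:E |
    f in [set f | wiener r f /\ (wnorm r f <= 1)%E]].

(* The minimum over the positive integers n, equal to +oo when no n is
   admissible. *)
Definition info_complexity d (r : 'rV[int]_d -> R) (eps : R) : \bar R :=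
  ereal_inf [set n%:R%:E | n in [set n : nat | (0 < n)%N /\
    exists Q : algorithm d n, (worst_case_error r Q <= eps%:E)%E]].

Definition r_one d (k : 'rV[int]_d) : R := 1.

Definition supp d (k : 'rV[int]_d) : {set 'I_d} :=
  [set j : 'I_d | k ord0 j != 0]%SET.

(* lne is the extended logarithm, with lne 0 = -oo. It is applied to values
   that are at least 1, then at least 0, so no junk value occurs. *)
Definition r_loglog d (k : 'rV[int]_d) : R :=
  if k == 0 then 1 else
  fine (maxe 1 (lne (lne
    (\big[mine/+oo]_(j in supp k) (`|k ord0 j|%N%:R)%:E))))%E.

Lemma r_loglog_ge1 d (k : 'rV[int]_d) : 1 <= r_loglog k.
Proof.
rewrite /r_loglog; case: eqP => // /eqP k0.
have lney (x : \bar R) : (x < +oo -> lne x < +oo)%E.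
  by case: x => [x| |]//= _; case: ifPn => // _; rewrite ltry.
have [j kj] : exists j, k ord0 j != 0.
  have /existsP[i /existsP[j]] : [exists i, exists j, k i j != 0].
    apply: contraNT k0 => /existsPn h; apply/eqP/matrixP => i j.
    by have /existsPn/(_ j)/negPn/eqP -> := h i; rewrite mxE.
  by rewrite (ord1 i) => kj; exists j.
have : (\big[mine/+oo]_(j in supp k) (`|k ord0 j|%N%:R : R)%:E < +oo)%E.
  by rewrite (bigD1 j) ?inE//= gt_min ltry.
move=> /lney/lney; set x := lne _ => x_lty.
have x1 : (1 <= maxe 1 x)%E by rewrite le_max lexx.
rewrite -lee_fin fineK// fin_real//.
by rewrite gt_max x_lty ltry (lt_le_trans _ x1)// ltNyr.
Qed.

End wiener.

(* Main.v *)
Require Import Defs.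
From mathcomp Require Import all_boot all_order all_algebra.
From mathcomp Require Import all_classical all_reals all_analysis.
From mathcomp Require Import measurable_realfun complex lra ring zify.

(** Lower bounds. If a cubature formula with weights [c_h] and [n] points
    [x_h] has small error, then [S(m) = sum_h c_h cos (2 pi m x_h)], with [x_h]
    now denoting first coordinates, is close to 1 at [m = 0] and small at the
    frequencies [m > 0] of small weight. The matrix [S(k - l)] has rank at most
    [2n], hence its entrywise [t]-th power has rank at most [(t+1)^(2n)]; but a
    diagonally dominant matrix is invertible. Hence [(1 - e)^t] is at most
    [(t+1)^(2n) (e rho)^t] when [e] bounds the error and [rho] bounds the weight
    of the frequencies up to [(t+1)^(2n)]. Unlike simultaneous Diophantine
    approximation of the points, this needs no control on the weights [c_h].
    For [r = 1], letting [t] grow forces [e >= 1/2]; for the iterated logarithm,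
    [t] of order [n^2] gives [e >= 1 / (8 log (3n))].

    Upper bound for [r = 1]. The formula [f(x0) / 2] has error at most 1/2 since
    [I(f) - f(x0)/2 = hat f(0)/2 - 1/2 sum_(k <> 0) hat f(k) e(k.x0)]. Fourier
    inversion is avoided by testing [f] against powers of
    [prod_j sin^2 (pi x_j)]: these are nonnegative trigonometric polynomials, so
    their zeroth coefficient dominates the others, and their mass concentrates at
    the centre [x0] of the cube. *)

Import Order.TTheory GRing.Theory Num.Theory.
Import numFieldNormedType.Exports.

Set Implicit Arguments.
Unset Strict Implicit.
Unset Printing Implicit Defensive.

Local Open Scope classical_set_scope.
Local Open Scope ring_scope.

(** * Entrywise powers of low-rank matrices *)

Lemma exists_left_kernel (F : fieldType) (m n : nat) (A : 'M[F]_(m, n)) :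
  (n < m)%N -> exists2 v : 'rV_m, v != 0 & v *m A = 0.
Proof.
move=> nm; have : kermx A != 0.
  rewrite kermx_eq0; apply/negP => /eqP rA.
  by have := rank_leq_col A; rewrite rA leqNgt nm.
by case/rowV0Pn => v /sub_kermxP vA v0; exists v.
Qed.

(** The exponent vector of the monomial obtained by multiplying variables along [f]. A fiber has at
    most [t] elements, so [inord] never truncates. *)
Definition fiber_count (t p : nat) (f : {ffun 'I_t -> 'I_p}) :
    {ffun 'I_p -> 'I_t.+1} := [ffun j => inord #|[pred i | f i == j]|].

Lemma prod_fiber_count (F : comRingType) (t p : nat) (f : {ffun 'I_t -> 'I_p})
    (a : 'I_p -> F) :
  \prod_(i < t) a (f i) = \prod_(j < p) a j ^+ fiber_count f j.
Proof.
rewrite (partition_big f xpredT)//=; apply: eq_bigr => j _.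
rewrite (eq_bigr (fun=> a j)) => [|i /eqP ->//].
rewrite prodr_const ffunE inordK// ltnS.
by rewrite -[leqRHS]card_ord; exact: max_card.
Qed.

(* The entrywise [t]-th power of a matrix of rank [p] factors through a space
   of dimension [t.+1 ^ p], with one coordinate per exponent vector. *)
Lemma hadamard_expr_factor (F : comRingType) (m n p t : nat)
    (U : 'M[F]_(m, p)) (V : 'M[F]_(p, n)) :
  exists (U' : 'M[F]_(m, t.+1 ^ p)) (V' : 'M[F]_(t.+1 ^ p, n)),
    forall i j, (U' *m V') i j = (U *m V) i j ^+ t.
Proof.
pose E := {ffun 'I_p -> 'I_t.+1}.
have cE : #|E| = (t.+1 ^ p)%N by rewrite card_ffun !card_ord.
rewrite -cE.
exists (\matrix_(i, c) \prod_j U i j ^+ (enum_val c : E) j).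
(* The second factor carries the multinomial coefficient: the number of [f] with the given exponent
   vector. *)
exists (\matrix_(c, k) ((\prod_j V j k ^+ (enum_val c : E) j)
  *+ #|[pred f | fiber_count f == enum_val c]|)).
move=> i k; rewrite !mxE -[in RHS](card_ord t) -prodr_const.
rewrite bigA_distr_bigA [RHS](partition_big (@fiber_count t p) xpredT)//=.
rewrite [RHS](reindex (@enum_val E predT)) /=; last first.
  by apply: onW_bij; exact: enum_val_bij.
apply: eq_bigr => c _; rewrite !mxE.
rewrite [RHS](eq_bigr (fun=> (\prod_j U i j ^+ (enum_val c : E) j)
  * (\prod_j V j k ^+ (enum_val c : E) j))).
  by rewrite sumr_const mulrnAr.
move=> f /eqP fc; rewrite big_split/= (prod_fiber_count f (U i)).
by rewrite (prod_fiber_count f (V^~ k)) fc.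
Qed.

(** The entrywise power factors through fewer than [N.+1] dimensions, so a nonzero [v] kills it from
    the left. In the column [l] where [v] is largest in modulus, the diagonal term must be balanced
    by the [N] others, each at most [|v_l| * eta ^+ t]. *)
Lemma hadamard_expr_diag_le (F : realFieldType) (p N t : nat)
    (U : 'M[F]_(N.+1, p)) (V : 'M[F]_(p, N.+1)) (a eta : F) :
  (t.+1 ^ p <= N)%N -> 0 <= a ->
  (forall k, a <= `|(U *m V) k k|) ->
  (forall k l, k != l -> `|(U *m V) k l| <= eta) ->
  a ^+ t <= N%:R * eta ^+ t.
Proof.
move=> tN a0 Ma Meta.
have [U' [V' UV]] := hadamard_expr_factor t U V.
have [v v0 vU] := exists_left_kernel U' tN.
case: (@arg_maxP _ _ _ ord0 xpredT (fun k => `|v ord0 k|)) => // l _ lmax.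
have vl0 : 0 < `|v ord0 l|.
  rewrite normr_gt0; apply: contra v0 => /eqP vl; apply/eqP/rowP => k.
  apply/eqP; rewrite mxE -normr_le0.
  by have := lmax k isT; rewrite vl normr0.
have : v *m U' *m V' = 0 by rewrite vU mul0mx.
rewrite -mulmxA => /rowP/(_ l); rewrite [X in X = _]mxE [X in _ = X]mxE.
rewrite (bigD1 l)//= => /eqP; rewrite addr_eq0 UV => /eqP vM.
rewrite -(ler_pM2l vl0).
apply: (@le_trans _ _ `|v ord0 l * (U *m V) l l ^+ t|).
  by rewrite normrM normrX ler_wpM2l// lerXn2r// nnegrE.
rewrite vM normrN; apply: le_trans (ler_norm_sum _ _ _) _.
apply: (@le_trans _ _ (\sum_(k < N.+1 | k != l) `|v ord0 l| * eta ^+ t)).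
  apply: ler_sum => k kl; rewrite normrM UV normrX ler_pM//.
    exact: lmax.
  rewrite lerXn2r ?nnegrE//; last exact: Meta.
  exact: le_trans (Meta _ _ kl).
by rewrite sumr_const cardC1 card_ord mulrCA mulr_natl.
Qed.

Section cosine_sum.
Variable R : realType.

(** The subtraction formula for the cosine splits the matrix of entries [S(k - l)] into a cosine
    block and a sine block, so it factors through dimension [n + n]. Its diagonal is constant, equal
    to [S(0)], the sum of the weights. *)
Lemma cosine_sum_expr_le n (c x : 'I_n -> R) t (eta : R) :
  (forall m, (0 < m <= t.+1 ^ (n + n))%N ->
    `|\sum_(h < n) c h * cos (2 * pi * m%:R * x h)| <= eta) ->
  `|\sum_(h < n) c h| ^+ t <= (t.+1 ^ (n + n))%:R * eta ^+ t.
Proof.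
move=> ceta; set N := (t.+1 ^ (n + n))%N in ceta *.
pose w (k : 'I_N.+1) h := 2 * pi * k%:R * x h.
pose U := row_mx (\matrix_(k < N.+1, h < n) (c h * cos (w k h)))
  (\matrix_(k < N.+1, h < n) (c h * sin (w k h))).
pose V := col_mx (\matrix_(h < n, k < N.+1) cos (w k h))
  (\matrix_(h < n, k < N.+1) sin (w k h)).
have UV k l : (U *m V) k l = \sum_(h < n) c h * cos (w k h - w l h).
  rewrite mul_row_col !mxE -big_split; apply: eq_bigr => h _ /=.
  by rewrite !mxE cosB mulrDr !mulrA.
apply: (@hadamard_expr_diag_le _ _ _ _ U V) => // [k|k l kl].
  by rewrite UV; under [in leRHS]eq_bigr do rewrite subrr cos0 mulr1.
(* Cosine is even, so only positive differences [k - l] matter, and they do not exceed [N]. *)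
wlog lk : k l kl / (l < k)%N => [wl|].
  have := kl; rewrite neq_ltn => /orP[kl'|]; last exact: wl.
  have := wl l k; rewrite eq_sym => /(_ kl kl'); rewrite !UV.
  by under eq_bigr do rewrite -cosN opprB.
have := ceta (k - l)%N.
rewrite subn_gt0 lk (leq_trans (leq_subr _ _)) -1?ltnS// => /(_ isT).
rewrite UV; under eq_bigr => h _ do rewrite natrB ?(ltnW lk)//.
by under [in X in _ -> X]eq_bigr => h _ do rewrite /w -mulrBl -mulrBr.
Qed.

End cosine_sum.

(** * Integration over the unit cube *)

Section cube_integral.
Variable R : realType.
Local Notation T := (measurableTypeR R).
Local Notation mu d := (lebesgue_tuple R d).
Local Notation tcube d := (@row_of R d @^-1` @cube R d).

Lemma tcubeE d : tcube d = [set t | forall i, `[0, 1[%classic (tnth t i)].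
Proof.
by apply/seteqP; split => t /= + i => /(_ i); rewrite mxE in_itv.
Qed.

Lemma measurable_tnth_set d (A : 'I_d -> set T) :
  (forall i, measurable (A i)) ->
  measurable [set t : d.-tuple T | forall i, A i (tnth t i)].
Proof.
move=> mA; rewrite (_ : mkset _ = \bigcap_(i in [set: 'I_d])
    ((fun t : d.-tuple T => tnth t i) @^-1` A i)); last first.
  by apply/seteqP; split=> t h i => [_|]; exact: h.
apply: fin_bigcap_measurable => // i _.
by rewrite -[X in measurable X]setTI; exact: measurable_tnth.
Qed.

Lemma measurable_tcube d : measurable (tcube d).
Proof.
rewrite tcubeE; apply: (@measurable_tnth_set _ (fun=> `[0%R, 1%R[%classic)) => i.
exact: measurable_itv.
Qed.

Lemma lebesgue_tcube d : mu d (tcube d) = 1%E.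
Proof.
rewrite tcubeE (@lebesgue_tuple_box R d (fun=> `[0%R, 1%R[%classic)).
  by rewrite big1// => i _; rewrite lebesgue_measure_itv/= lte01 oppr0 adde0.
by move=> i; exact: measurable_itv.
Qed.

Lemma bounded_cube_integrable d (g : 'rV[R]_d -> R) (M : R) :
  measurable_fun setT (g \o @row_of R d) ->
  (forall x, `|g x| <= M) -> cube_integrable g.
Proof.
move=> mg gM; apply: measurable_bounded_integrable.
- exact: measurable_tcube.
- by rewrite /= lebesgue_tcube ltry.
- exact: measurable_funTS.
- exists M; split; first exact: num_real.
  by move=> N MN t _ /=; exact: le_trans (gM _) (ltW MN).
Qed.

Lemma cube_integrableMl d (g h : 'rV[R]_d -> R) (M : R) :
  cube_integrable g -> measurable_fun setT (h \o @row_of R d) ->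
  (forall x, `|h x| <= M) -> cube_integrable (fun x => g x * h x).
Proof.
move=> ig mh hM.
have := integrableMl (@measurable_tcube d) ig (h := h \o @row_of R d); apply.
  exact: measurable_funTS.
exists M; split; first exact: num_real.
by move=> N MN t _ /=; exact: le_trans (hM _) (ltW MN).
Qed.

Lemma cube_integrableZl d (a : R) (g : 'rV[R]_d -> R) :
  cube_integrable g -> cube_integrable (fun x => a * g x).
Proof. by move/(integrableZl (@measurable_tcube d) a). Qed.

Lemma cube_integrableD d (g h : 'rV[R]_d -> R) : cube_integrable g ->
  cube_integrable h -> cube_integrable (fun x => g x + h x).
Proof. by move=> ig /(integrableD (@measurable_tcube d) ig). Qed.

Lemma cube_integrableB d (g h : 'rV[R]_d -> R) : cube_integrable g ->
  cube_integrable h -> cube_integrable (fun x => g x - h x).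
Proof. by move=> ig /(integrableB (@measurable_tcube d) ig). Qed.

Lemma cube_integrable_sum d (I : Type) (s : seq I) (g : I -> 'rV[R]_d -> R) :
  (forall i, cube_integrable (g i)) ->
  cube_integrable (fun x => \sum_(i <- s) g i x).
Proof.
move=> ig; rewrite /cube_integrable.
under [X in integrable _ _ X]eq_fun do rewrite -sumEFin.
by apply: integrable_sum => [|i _]; [exact: measurable_tcube|exact: ig].
Qed.

Lemma cube_intZl d (a : R) (g : 'rV[R]_d -> R) : cube_integrable g ->
  cube_int (fun x => a * g x) = a * cube_int g.
Proof. by move=> ig; rewrite /cube_int RintegralZl//; exact: measurable_tcube. Qed.

Lemma cube_intD d (g h : 'rV[R]_d -> R) : cube_integrable g ->
  cube_integrable h -> cube_int (fun x => g x + h x) = cube_int g + cube_int h.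
Proof. by move=> ig ih; rewrite /cube_int RintegralD//; exact: measurable_tcube. Qed.

Lemma cube_intB d (g h : 'rV[R]_d -> R) : cube_integrable g ->
  cube_integrable h -> cube_int (fun x => g x - h x) = cube_int g - cube_int h.
Proof. by move=> ig ih; rewrite /cube_int RintegralB//; exact: measurable_tcube. Qed.

Lemma cube_int_cst d (a : R) : cube_int (fun _ : 'rV[R]_d => a) = a.
Proof.
rewrite /cube_int Rintegral_cst; last exact: measurable_tcube.
by rewrite /= lebesgue_tcube mulr1.
Qed.

Lemma cube_int_sum d (I : Type) (s : seq I) (g : I -> 'rV[R]_d -> R) :
  (forall i, cube_integrable (g i)) ->
  cube_int (fun x => \sum_(i <- s) g i x) = \sum_(i <- s) cube_int (g i).
Proof.
move=> ig; elim: s => [|i s IHs].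
  rewrite big_nil -[RHS](cube_int_cst d 0); congr cube_int.
  by apply/funext => x; rewrite big_nil.
rewrite big_cons -IHs -cube_intD//; last exact: cube_integrable_sum.
by congr cube_int; apply/funext => x; rewrite big_cons.
Qed.

Lemma le_cube_int d (g h : 'rV[R]_d -> R) :
  cube_integrable g -> cube_integrable h ->
  (forall x, cube x -> g x <= h x) -> cube_int g <= cube_int h.
Proof.
move=> ig ih gh; apply: le_Rintegral => // [|t /gh//].
exact: measurable_tcube.
Qed.

Lemma cube_integrable_norm d (g : 'rV[R]_d -> R) :
  cube_integrable g -> cube_integrable (fun x => `|g x|).
Proof. by move/integrable_norm. Qed.

Lemma le_norm_cube_int d (g : 'rV[R]_d -> R) : cube_integrable g ->
  `|cube_int g| <= cube_int (fun x => `|g x|).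
Proof. by move=> ig; apply: le_normr_Rintegral => //; exact: measurable_tcube. Qed.

Lemma eq_cube_int d (g h : 'rV[R]_d -> R) :
  (forall x, g x = h x) -> cube_int g = cube_int h.
Proof. by move=> gh; congr cube_int; exact/funext. Qed.

Lemma measurable_dotZ d (k : 'rV[int]_d) :
  measurable_fun setT (dotZ k \o @row_of R d).
Proof.
apply: measurable_sum => i /=.
under eq_fun do rewrite mxE.
by apply: measurable_funM => //; exact: measurable_tnth.
Qed.

Lemma measurable_cos_dotZ d (k : 'rV[int]_d) (w : R) :
  measurable_fun setT ((fun x => cos (2 * pi * dotZ k x + w)) \o @row_of R d).
Proof.
apply: (@measurableT_comp _ _ _ _ _ _ (@cos R) _
  (fun t => 2 * pi * dotZ k (row_of t) + w)).
exact: (continuous_measurable_fun (@continuous_cos R)).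
apply: measurable_funD => //; apply: measurable_funM => //.
exact: measurable_dotZ.
Qed.

Lemma cube_integrable_cos d (k : 'rV[int]_d) (w : R) :
  cube_integrable (fun x => cos (2 * pi * dotZ k x + w)).
Proof.
apply: (@bounded_cube_integrable _ _ 1); first exact: measurable_cos_dotZ.
by move=> x; exact: cos_max.
Qed.

Lemma sin_cos_2piz (m : int) :
  sin (2 * pi * m%:~R : R) = 0 /\ cos (2 * pi * m%:~R : R) = 1.
Proof.
have E (n : nat) : 2 * pi * n%:R = 0 + (pi *+ 2) *+ n :> R.
  by rewrite add0r -[RHS]mulr_natr -(mulr_natl pi).
have S (n : nat) : sin (2 * pi * n%:R : R) = 0.
  by rewrite E periodicn ?sin0//; exact: sinD2pi.
have C (n : nat) : cos (2 * pi * n%:R : R) = 1.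
  by rewrite E periodicn ?cos0//; exact: cosD2pi.
case: m => n; first by rewrite S C.
by rewrite NegzE mulrNz mulrN sinN cosN S C oppr0.
Qed.

(** For [m] nonzero, the antiderivative [sin (a * x + w) / a] with [a = 2 pi m] takes the same value
    at 0 and 1. *)
Lemma integral_cos_itv (m : int) (w : R) :
  (\int[@lebesgue_measure R]_(x in `[0%R, 1%R[)
     (cos (2 * pi * (m%:~R * x) + w))%:E = (if m == 0 then cos w else 0)%:E)%E.
Proof.
have cc (a b : R) : continuous (fun x => cos (a * x + b)).
  move=> x; apply: continuous_comp; last exact: continuous_cos.
  by apply: cvgD; [apply: cvgM; [exact: cvg_cst|exact: cvg_id]|exact: cvg_cst].
rewrite integral_itv_bndo_bndc; last first.
  apply: measurable_funTS; apply/measurable_EFinP.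
  apply: continuous_measurable_fun.
  by under eq_fun do rewrite mulrA; exact: cc.
case: ifPn => [/eqP ->|m0].
  under eq_integral do rewrite mul0r mulr0 add0r.
  by rewrite integral_cst//= lebesgue_measure_itv/= lte01 oppr0 adde0 mule1.
pose a : R := 2 * pi * m%:~R.
have a0 : a != 0 by rewrite !mulf_neq0// ?intr_eq0// gt_eqF// pi_gt0.
pose F (x : R) := a^-1 * sin (a * x + w).
have dF (x : R) : is_derive x (1 : R) F (cos (a * x + w)).
  have dl : is_derive x (1 : R) (a \*: (@id R) + cst w) (a *: 1 + 0).
    exact: is_deriveD.
  have ds := is_derive1_comp (is_derive_sin ((a \*: (@id R) + cst w) x)) dl.
  apply: (is_derive_eq (is_deriveZ a^-1 ds)).
  by rewrite /GRing.scale/= addr0 mulr1 [cos _ * a]mulrC mulKf.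
under eq_integral do rewrite mulrA.
rewrite (@continuous_FTC2 _ _ F) ?ltr01//.
- rewrite /F -EFinB mulr0 mulr1 add0r sinD.
  by have [-> ->] := sin_cos_2piz m; rewrite mul0r add0r mul1r subrr.
- by apply: continuous_subspaceT; exact: cc.
- split.
  + by move=> x _; exact: (@ex_derive _ _ _ _ _ _ _ (dF x)).
  + apply: cvg_at_right_filter; apply: differentiable_continuous.
    by apply/derivable1_diffP; exact: (@ex_derive _ _ _ _ _ _ _ (dF _)).
  + apply: cvg_at_left_filter; apply: differentiable_continuous.
    by apply/derivable1_diffP; exact: (@ex_derive _ _ _ _ _ _ _ (dF _)).
- by move=> x _; rewrite derive1E (@derive_val _ _ _ _ _ _ _ (dF x)).
Qed.

End cube_integral.

(** * Orthogonality of characters *)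

Section orthogonality.
Variable R : realType.
Local Notation T := (measurableTypeR R).
Local Notation mu d := (lebesgue_tuple R d).
Local Notation tcube d := (@row_of R d @^-1` @cube R d).

Lemma tcons_tcube d :
  @tcons R d @^-1` tcube d.+1 = `[0%R, 1%R[%classic `*` tcube d.
Proof.
apply/seteqP; split => -[x t] /=.
  move=> h; split; first by have := h ord0; rewrite mxE in_itv.
  by move=> i; have := h (lift ord0 i); rewrite !mxE tnthS.
move=> [h0 h] i; rewrite mxE.
case: (unliftP ord0 i) => [j ->|->]; last by move: h0; rewrite in_itv.
by have := h j; rewrite mxE tnthS.
Qed.

(** Fubini for the pushforward along [tcons]; the bound [M] on a cube of finite measure supplies
    integrability. *)
Lemma integral_lebesgue_tupleS d (f : d.+1.-tuple T -> R) (M : R) :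
  measurable_fun setT f -> (forall t, `|f t| <= M) ->
  (\int[mu d.+1]_(t in tcube d.+1) (f t)%:E =
   \int[@lebesgue_measure R]_(x in `[0%R, 1%R[)
     \int[mu d]_(t in tcube d) (f (tcons (x, t)))%:E)%E.
Proof.
move=> mf fM.
have mI : measurable (`[0%R, 1%R[%classic `*` tcube d : set (T * d.-tuple T)).
  by apply: measurableX; [exact: measurable_itv|exact: measurable_tcube].
have mft : measurable_fun setT (f \o @tcons R d).
  by apply: measurableT_comp => //; exact: measurable_tcons.
have int_f : (@lebesgue_measure R \x mu d)%E.-integrable
    (@tcons R d @^-1` tcube d.+1) (EFin \o (f \o @tcons R d)).
  rewrite tcons_tcube; apply: measurable_bounded_integrable => //.
  - rewrite /= product_measure1E//; last exact: measurable_tcube.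
    rewrite lebesgue_tcube /= lebesgue_measure_itv/=.
    by rewrite lte01 oppr0 adde0 mule1 ltry.
  - exact: measurable_funTS.
  - exists M; split; first exact: num_real.
    by move=> N MN p _ /=; exact: le_trans (fM _) (ltW MN).
rewrite /= integral_pushforward//; last 3 first.
- exact: measurable_tcons.
- exact/measurable_EFinP.
- exact: measurable_tcube.
(* Fubini is applied on the whole product space, so the integrand is first extended by zero outside
   the cube. *)
rewrite integral_mkcond -integral12_prod_meas1; last first.
  apply/integrable_restrict => //; first by rewrite tcons_tcube.
  by rewrite setTI.
rewrite [RHS]integral_mkcond; apply: eq_integral => x _.
rewrite /fubini_F tcons_tcube [RHS]patchE; case: ifPn => [xI|xI].
  rewrite [RHS]integral_mkcond; apply: eq_integral => t _.
  rewrite !patchE; congr (if _ then _ else _).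
  apply/idP/idP => [/set_mem[_ ?]|/set_mem ?]; first exact: mem_set.
  by apply: mem_set; split => //; exact: set_mem.
apply: integral0_eq => t _; rewrite patchE memNset// => -[/mem_set/= ].
by rewrite (negPf xI).
Qed.

(** The phase [w] drives the induction: after Fubini, the contribution of the first coordinate is
    absorbed into the phase of the integral over the remaining ones. *)
Lemma integral_cos_tcube d (k : 'rV[int]_d) (w : R) :
  (\int[mu d]_(t in tcube d) (cos (2 * pi * dotZ k (row_of t) + w))%:E =
   (if k == 0 then cos w else 0)%:E)%E.
Proof.
elim: d k w => [|d IHd] k w.
  rewrite [k]thinmx0 eqxx /= integral_dirac//.
  - rewrite diracE mem_set ?mul1e; last by move=> -[].
    by rewrite /dotZ big_ord0 mulr0 add0r.
  - exact: measurable_tcube.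
  - by apply: measurable_funTS; apply/measurable_EFinP; exact: measurable_cos_dotZ.
rewrite (integral_lebesgue_tupleS (measurable_cos_dotZ k w) (M := 1)); last first.
  by move=> t; exact: cos_max.
pose k' : 'rV[int]_d := \row_i k ord0 (lift ord0 i).
have kE : (k == 0) = (k' == 0) && (k ord0 ord0 == 0).
  apply/eqP/andP => [k0|[/eqP k'0 /eqP k0]].
    by split; [apply/eqP/rowP => i|]; rewrite ?mxE k0 !mxE.
  apply/rowP => i; rewrite [RHS]mxE.
  case: (unliftP ord0 i) => [j ->|->//].
  by have := congr1 (fun A : 'rV_d => A ord0 j) k'0; rewrite !mxE.
have dE x (t : d.-tuple T) : 2 * pi * dotZ k (row_of (tcons (x, t))) + w =
    2 * pi * dotZ k' (row_of t) + (2 * pi * ((k ord0 ord0)%:~R * x) + w).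
  have -> : dotZ k (row_of (tcons (x, t))) =
      (k ord0 ord0)%:~R * x + dotZ k' (row_of t).
    rewrite /dotZ big_ord_recl mxE; congr (_ + _).
    by apply: eq_bigr => i _; rewrite !mxE tnthS.
  by rewrite mulrDr -addrA addrCA.
under eq_integral => x _.
  under eq_integral => t _ do rewrite /= dE.
  rewrite IHd.
  over.
rewrite kE; case: (k' == 0) => /=; first exact: integral_cos_itv.
exact: integral0.
Qed.

Lemma cube_int_cos d (k : 'rV[int]_d) (w : R) :
  cube_int (fun x => cos (2 * pi * dotZ k x + w)) = if k == 0 then cos w else 0.
Proof. by rewrite /cube_int /Rintegral integral_cos_tcube. Qed.

End orthogonality.

(** * Cosine test functions *)

Section fourier_cosine.
Variable R : realType.

Lemma dotZD d (k l : 'rV[int]_d) (x : 'rV[R]_d) :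
  dotZ (k + l) x = dotZ k x + dotZ l x.
Proof.
rewrite /dotZ -big_split; apply: eq_bigr => i _ /=.
by rewrite mxE rmorphD mulrDl.
Qed.

Lemma dotZN d (k : 'rV[int]_d) (x : 'rV[R]_d) : dotZ (- k) x = - dotZ k x.
Proof.
rewrite /dotZ -sumrN; apply: eq_bigr => i _ /=.
by rewrite mxE rmorphN mulNr.
Qed.

Lemma dotZ0 d (x : 'rV[R]_d) : dotZ 0 x = 0.
Proof. by rewrite /dotZ big1// => i _; rewrite mxE mul0r. Qed.

Lemma Re_fourier d (f : 'rV[R]_d -> R) k :
  complex.Re (fourier f k) = cube_int (fun x => f x * cos (2 * pi * dotZ k x + 0)).
Proof.
rewrite /fourier /cube_intC/=; apply: eq_cube_int => x.
by rewrite mul0r subr0 cosN addr0.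
Qed.

(** A phase of [pi / 2] turns the cosine into minus the sine, so the real and imaginary parts are
    instances of one cosine integral, at phases [0] and [pi / 2]. *)
Lemma Im_fourier d (f : 'rV[R]_d -> R) k :
  complex.Im (fourier f k) =
  cube_int (fun x => f x * cos (2 * pi * dotZ k x + pi / 2)).
Proof.
rewrite /fourier /cube_intC/=; apply: eq_cube_int => x.
by rewrite mul0r addr0 sinN cosDpihalf.
Qed.

Lemma cosMcos (x y : R) : cos x * cos y = 2^-1 * cos (x + y) + 2^-1 * cos (x - y).
Proof.
rewrite cosD cosB -mulrDr addrACA addNr addr0 -mulr2n -[X in _^-1 * X]mulr_natl.
by rewrite mulKf// pnatr_eq0.
Qed.

(** Product-to-sum followed by orthogonality. The two indicators add up when [k = l = 0], which
    absorbs the factor 1/2. *)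
Lemma cube_int_cosMcos d (l k : 'rV[int]_d) (w : R) :
  cube_int (fun x => cos (2 * pi * dotZ l x) * cos (2 * pi * dotZ k x + w)) =
  2^-1 * ((k == - l)%:R + (k == l)%:R) * cos w.
Proof.
rewrite (@eq_cube_int _ _ _ (fun x =>
    2^-1 * cos (2 * pi * dotZ (l + k) x + w)
    + 2^-1 * cos (2 * pi * dotZ (l - k) x + - w))); last first.
  move=> x; rewrite cosMcos; congr (_ * cos _ + _ * cos _).
    by rewrite addrA -mulrDr -dotZD.
  by rewrite opprD addrA -mulrBr -dotZN -dotZD.
rewrite cube_intD; [|exact: cube_integrableZl (cube_integrable_cos _ _)..].
rewrite !cube_intZl; [|exact: cube_integrable_cos..].
rewrite !cube_int_cos addrC subr_eq0 addr_eq0 cosN (eq_sym l k) -eqr_oppLR (eq_sym _ k).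
by rewrite addrC -mulrDr -mulrA mulrDl; congr (_ * (_ + _)); case: ifP => _;
  rewrite ?mul1r ?mul0r.
Qed.

Lemma fourier_cos d (a : R) (l k : 'rV[int]_d) :
  fourier (fun x => a * cos (2 * pi * dotZ l x)) k =
  ((a * (2^-1 * ((k == - l)%:R + (k == l)%:R)))%:C)%C.
Proof.
have E w : cube_int (fun x => a * cos (2 * pi * dotZ l x)
    * cos (2 * pi * dotZ k x + w)) =
    a * (2^-1 * ((k == - l)%:R + (k == l)%:R) * cos w).
  rewrite -cube_int_cosMcos -cube_intZl.
    by apply: eq_cube_int => x; rewrite mulrA.
  apply: (@cube_integrableMl _ _ _ _ 1); last by move=> x; exact: cos_max.
    under eq_fun do rewrite -[X in cos X]addr0.
    exact: cube_integrable_cos.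
  exact: measurable_cos_dotZ.
have := Re_fourier (fun x => a * cos (2 * pi * dotZ l x)) k.
have := Im_fourier (fun x => a * cos (2 * pi * dotZ l x)) k.
rewrite !E cos0 cos_pihalf !mulr0 mulr1.
by case: fourier => x y /= -> ->.
Qed.

Lemma normc_real (x : R) : Normc.normc (x%:C)%C = `|x|.
Proof. by rewrite /Normc.normc/= expr0n addr0 sqrtr_sqr. Qed.

Lemma continuous_lincomb (T : topologicalType) (I : Type) (s : seq I)
    (a : I -> R) (f : I -> T -> R) :
  (forall i, continuous (f i)) -> continuous (fun x => \sum_(i <- s) a i * f i x).
Proof.
move=> cf; elim: s => [|i s IHs].
  rewrite (_ : (fun _ => _) = fun=> 0); first exact: cst_continuous.
  by apply/funext => x; rewrite big_nil.
rewrite (_ : (fun _ => _) = fun x => a i * f i x + \sum_(j <- s) a j * f j x);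
  last by apply/funext => x; rewrite big_cons.
move=> x; apply: cvgD; last exact: IHs.
by apply: cvgM; [exact: cvg_cst|exact: cf].
Qed.

Lemma continuous_dotZ d (k : 'rV[int]_d) : continuous (@dotZ R d k).
Proof.
apply: (@continuous_lincomb 'rV[R]_d 'I_d _ (fun i => (k ord0 i)%:~R)
  (fun i x => x ord0 i)) => i.
exact: coord_continuous.
Qed.

Lemma continuous_cos_comp (T : topologicalType) (a b : R) (f : T -> R) :
  continuous f -> continuous (fun x => a * cos (b * f x)).
Proof.
move=> cf x; apply: cvgM; first exact: cvg_cst.
apply: (@continuous_comp _ _ _ (fun x => b * f x) (@cos R)).
  by apply: cvgM; [exact: cvg_cst|exact: cf].
exact: continuous_cos.
Qed.

Lemma esum_delta (I : choiceType) (i0 : I) (a : R) : 0 <= a ->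
  (\esum_(i in [set: I]) ((i == i0)%:R * a)%:E = a%:E)%E.
Proof.
move=> a0; rewrite -[RHS](@esum_set1 _ _ i0 (fun=> a%:E)) ?lee_fin//.
rewrite [RHS]esum_mkcond; apply: eq_esum => i _.
have [->|ii0] := eqVneq i i0; first by rewrite mem_set// mul1r.
by rewrite memNset ?mul0r//= => /eqP; rewrite (negPf ii0).
Qed.

(** The mass splits evenly between the frequencies [l] and [- l], which have equal weight; for
    [l = 0] the two halves fall on the same coefficient. *)
Lemma wnorm_cos d (r : 'rV[int]_d -> R) (l : 'rV[int]_d) :
  0 < r l -> r (- l) = r l ->
  wnorm r (fun x => (r l)^-1 * cos (2 * pi * dotZ l x)) = 1%E.
Proof.
move=> rl0 rN; rewrite /wnorm.
transitivity (\esum_(k in [set: 'rV[int]_d])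
    (((k == - l)%:R * 2^-1 : R)%:E + ((k == l)%:R * 2^-1 : R)%:E))%E.
  apply: eq_esum => k _; rewrite fourier_cos normc_real -EFinD; congr (_%:E).
  rewrite ger0_norm; last first.
    by rewrite mulr_ge0 ?mulr_ge0 ?addr_ge0 ?invr_ge0// ltW.
  transitivity ((k == - l)%:R * ((r l)^-1 * r k) * 2^-1
      + (k == l)%:R * ((r l)^-1 * r k) * 2^-1); first by ring.
  have D l' : r l' = r l -> (k == l')%:R * ((r l)^-1 * r k) = (k == l')%:R.
    by move=> rl'; have [->|_] := eqVneq k l'; rewrite ?mul0r// rl' mulVf ?gt_eqF// mul1r.
  by rewrite !D.
rewrite esumD; [|by move=> k _; rewrite lee_fin mulr_ge0..].
rewrite !esum_delta// -EFinD; congr (_%:E).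
by rewrite [RHS]splitr div1r.
Qed.

Lemma cube_int_scaled_cos d (a : R) (l : 'rV[int]_d) :
  cube_int (fun x => a * cos (2 * pi * dotZ l x)) = a * (l == 0)%:R.
Proof.
rewrite (@eq_cube_int _ _ _ (fun x => a * cos (2 * pi * dotZ l x + 0))).
  rewrite cube_intZl ?cube_int_cos ?cos0; last exact: cube_integrable_cos.
  by case: eqP.
by move=> x; rewrite addr0.
Qed.

Lemma wiener_cos d (r : 'rV[int]_d -> R) (l : 'rV[int]_d) :
  0 < r l -> r (- l) = r l ->
  wiener r (fun x => (r l)^-1 * cos (2 * pi * dotZ l x)).
Proof.
move=> rl0 rN; split.
- by apply: continuous_subspaceT; apply: continuous_cos_comp; exact: continuous_dotZ.
- apply: cube_integrableZl.
  rewrite (_ : (fun _ => _) = fun x => cos (2 * pi * dotZ l x + 0)).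
    exact: cube_integrable_cos.
  by apply/funext => x; rewrite addr0.
- by rewrite wnorm_cos// ltry.
Qed.

(** The normalised cosine at [l] lies in the unit ball, so the algorithm is tested on it and the
    result rescaled by [r l]. *)
Lemma worst_case_error_cos d n (r : 'rV[int]_d -> R) (Q : algorithm R d n)
    (l : 'rV[int]_d) (e : R) :
  0 < r l -> r (- l) = r l -> (worst_case_error r Q <= e%:E)%E ->
  `|(l == 0)%:R - \sum_(h < n) coefs Q h * cos (2 * pi * dotZ l (points Q h))|
    <= e * r l.
Proof.
move=> rl0 rN Qe; rewrite -ler_pdivrMr//.
rewrite -lee_fin; apply: le_trans Qe; apply: ereal_sup_ubound.
exists (fun x => (r l)^-1 * cos (2 * pi * dotZ l x)).
  by split; [exact: wiener_cos|rewrite wnorm_cos].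
congr (_%:E); rewrite cube_int_scaled_cos /apply_alg.
under eq_bigr do rewrite mulrCA.
by rewrite -mulr_sumr -mulrBr normrM gtr0_norm ?invr_gt0// mulrC.
Qed.

(** Frequencies on the first axis reduce the lower bounds to dimension one, which makes them uniform
    in [d]. For [m] nonzero the support is a single index, so the minimum in [r_loglog] is [m]
    itself. *)
Definition axis_freq d (m : nat) : 'rV[int]_d.+1 :=
  \row_j (if j == ord0 then m%:Z else 0).

Lemma dotZ_axis_freq d m (x : 'rV[R]_d.+1) :
  dotZ (axis_freq d m) x = m%:R * x ord0 ord0.
Proof.
rewrite /dotZ big_ord_recl mxE eqxx big1 ?addr0// => i _.
by rewrite mxE mul0r.
Qed.

Lemma axis_freq_eq0 d m : (axis_freq d m == 0) = (m == 0)%N.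
Proof.
apply/eqP/eqP => [/rowP/(_ ord0)|->]; first by rewrite !mxE eqxx => -[].
by apply/rowP => j; rewrite !mxE; case: ifP.
Qed.

Lemma worst_case_error_expr_le d n (r : 'rV[int]_d.+1 -> R)
    (Q : algorithm R d.+1 n) t (e rho : R) :
  r 0 = 1 -> e <= 1 -> (worst_case_error r Q <= e%:E)%E ->
  (forall m, (0 < m <= t.+1 ^ (n + n))%N ->
    [/\ 0 < r (axis_freq d m), r (- axis_freq d m) = r (axis_freq d m)
      & r (axis_freq d m) <= rho]) ->
  0 <= e /\ (1 - e) ^+ t <= (t.+1 ^ (n + n))%:R * (e * rho) ^+ t.
Proof.
move=> r0 e1 Qe rrho.
(* Frequency zero tests the constant function 1 and forces the weights to sum to nearly 1. *)
have Q1 : `|1 - \sum_(h < n) coefs Q h| <= e.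
  have := worst_case_error_cos (l := 0) _ _ Qe.
  rewrite oppr0 r0 mulr1 eqxx ltr01 => /(_ isT erefl).
  by under eq_bigr do rewrite dotZ0 mulr0 cos0 mulr1.
have e0 : 0 <= e by exact: le_trans Q1.
split => //; apply: (@le_trans _ _ (`|\sum_(h < n) coefs Q h| ^+ t)).
  rewrite lerXn2r ?nnegrE ?subr_ge0// lerBlDr -lerBlDl -[X in X - _](normr1 R).
  exact: le_trans (lerB_dist _ _) Q1.
apply: (cosine_sum_expr_le (x := fun h => points Q h ord0 ord0)) => m mN.
have [rm0 rmN rmrho] := rrho _ mN.
have := worst_case_error_cos rm0 rmN Qe.
have /andP[m0 _] := mN.
rewrite axis_freq_eq0 (gtn_eqF m0) sub0r normrN => wce.
apply: (@le_trans _ _ (e * r (axis_freq d m))); last exact: ler_wpM2l.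
apply: le_trans wce; rewrite le_eqVlt; apply/orP; left; apply/eqP.
by congr `|_|; apply: eq_bigr => h _; rewrite dotZ_axis_freq mulrA.
Qed.

End fourier_cosine.

(** * Lower bounds *)

Section lower_bounds.
Variable R : realType.

Lemma bernoulli_ineq (x : R) n : 0 <= x -> 1 + n%:R * x <= (1 + x) ^+ n.
Proof.
move=> x0; elim: n => [|n IHn]; first by rewrite mul0r addr0.
rewrite exprS; apply: (@le_trans _ _ ((1 + x) * (1 + n%:R * x))).
  rewrite mulrDl mul1r mulrDr mulr1 -natr1 mulrDl mul1r addrA -!addrA lerD2l.
  rewrite lerD2l lerDl; apply: mulr_ge0 => //; exact: mulr_ge0.
by apply: ler_wpM2l => //; rewrite addr_ge0.
Qed.

(** With [t = s * p.+1], Bernoulli's inequality for [(1 + x) ^+ s], raised to the power [p.+1],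
    grows like [s] to the [p.+1], while the left side grows only like [s] to the [p]. *)
Lemma exists_poly_lt_expr (q : R) (p : nat) :
  1 < q -> exists t, (t.+1 ^ p)%:R < q ^+ t.
Proof.
(* Capping [x] at 1 gives [x * s.+1%:R <= 1 + s%:R * x]. *)
move=> q1; pose x := Num.min 1 (q - 1).
have x0 : 0 < x by rewrite lt_min ltr01 subr_gt0.
have xq : 1 + x <= q by rewrite addrC -lerBrDr ge_min lexx orbT.
have x1 : x <= 1 by rewrite ge_min lexx.
pose b := (p.+1 ^ p)%:R / x ^+ p.+1.
have bS : b < (Num.bound b)%:R.
  by apply: archi_boundP; rewrite divr_ge0// exprn_ge0// ltW.
exists (Num.bound b * p.+1)%N; set s := Num.bound b in bS *.
apply: (@le_lt_trans _ _ ((p.+1 ^ p)%:R * (s.+1 ^ p)%:R)).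
  rewrite -natrM ler_nat -expnMn; have [->//|p0] := posnP p.
  by rewrite leq_exp2r//; nia.
apply: (@lt_le_trans _ _ ((x * s.+1%:R) ^+ p.+1)).
  rewrite exprMn [X in _ < _ * X]exprS -natrX mulrA ltr_pM2r; last first.
    by rewrite ltr0n expn_gt0.
  rewrite mulrC -ltr_pdivrMr ?exprn_gt0//; apply: lt_trans bS _.
  by rewrite ltr_nat.
have q0 : 0 <= q by exact: le_trans ler01 (ltW q1).
rewrite exprM lerXn2r ?nnegrE ?exprn_ge0//; first by rewrite mulr_ge0// ltW.
apply: (@le_trans _ _ ((1 + x) ^+ s)); last first.
  by rewrite lerXn2r// nnegrE addr_ge0// ltW.
apply: le_trans (bernoulli_ineq _ (ltW x0)).
by rewrite -natr1 mulrDr mulr1 addrC mulrC lerD2r.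
Qed.

Lemma half_le_worst_case_error d n (Q : algorithm R d.+1 n) :
  ((1 / 2)%:E <= worst_case_error (@r_one R d.+1) Q)%E.
Proof.
have [//|Qlt] := leP (1 / 2)%:E (worst_case_error (@r_one R d.+1) Q).
(* Raising the error bound to at least 1/3 makes [e] positive, so dividing by it is allowed, and
   also covers an error of minus infinity; [e < 1 / 2] makes the ratio [(1 - e) / e] exceed 1. *)
have [e [e3 e12 Qe]] : exists e : R, [/\ 1 / 3 <= e, e < 1 / 2
    & (worst_case_error (@r_one R d.+1) Q <= e%:E)%E].
  case: (worst_case_error _ _) Qlt => [w|//|].
    rewrite lte_fin => w2; exists (Num.max w (1 / 3)).
    by rewrite le_max lexx orbT gt_max w2 lee_fin le_max lexx; split => //; lra.
  by move=> _; exists (1 / 3); split; [lra|lra|exact: leNye].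
have [t tlt] : exists t, (t.+1 ^ (n + n))%:R < ((1 - e) / e) ^+ t.
  by apply: exists_poly_lt_expr; rewrite ltr_pdivlMr; lra.
have [||e0] := @worst_case_error_expr_le R d n _ Q t e 1 erefl _ Qe.
- lra.
- by move=> m _; split => //; rewrite /r_one ltr01.
rewrite mulr1 -ler_pdivrMr; last by rewrite exprn_gt0//; lra.
by rewrite -expr_div_n leNgt tlt.
Qed.

Lemma info_complexity_r_one d (eps : R) : (0 < d)%N -> 0 < eps < 1 / 2 ->
  info_complexity (@r_one R d) eps = +oo%E.
Proof.
case: d => [//|d] _ /andP[_ eps_lt].
rewrite /info_complexity [X in ereal_inf X](_ : _ = set0) ?ereal_inf0//.
apply/seteqP; split => // x [n [_ [Q Qeps]] nx].
have := le_trans (half_le_worst_case_error Q) Qeps.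
by rewrite lee_fin leNgt eps_lt.
Qed.

Lemma r_loglogN d (k : 'rV[int]_d) : r_loglog R (- k) = r_loglog R k.
Proof.
rewrite /r_loglog oppr_eq0; case: eqP => // _; congr (fine (maxe _ (lne (lne _)))).
by apply: eq_big => [i|i _]; rewrite ?inE !mxE ?oppr_eq0// abszN.
Qed.

Lemma r_loglog_axis_freq d (m n : nat) : (0 < n)%N ->
  (0 < m <= 2 ^ (2 * n * (2 * n + 2)))%N ->
  r_loglog R (axis_freq d m) <= 2 * ln (3 * n%:R).
Proof.
move=> n0 /andP[m0 mle]; rewrite /r_loglog axis_freq_eq0 (gtn_eqF m0).
rewrite (_ : \big[mine/+oo%E]_(j in _) _ = (m%:R)%:E); last first.
  rewrite (big_pred1 ord0) => [|j]; first by rewrite mxE eqxx.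
  by rewrite inE mxE -(prednK m0) /=; case: (j == ord0).
have n3 : 3 <= 3 * n%:R :> R by rewrite ler_peMr// ler1n.
(* Handles the value 1 in the maximum: the square root of e is at most 2, hence below [3 * n]. *)
have ln3 : 1 <= 2 * ln (3 * n%:R) :> R.
  rewrite -ler_pdivrMl// mulr1 -ler_expR lnK ?posrE; last lra.
  have := expR_ge1Dx (- (2^-1) : R); rewrite expRN => e2.
  have : expR (2^-1 : R) <= 2.
    by rewrite -[leRHS]invrK -[leLHS]invrK lef_pV2 ?posrE ?invr_gt0 ?expR_gt0//; lra.
  lra.
rewrite lne_EFin ?ltr0n//.
(* At [m = 1] the inner logarithm is 0 and the outer one is [-oo], so the weight is 1. *)
have [m1|m1] := leqP m 1.
  by rewrite le0_lneNy ?lee_fin ?ln_le0 ?lern1// maxeNy /=.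
have lnm : 0 < ln (m%:R : R) by rewrite ln_gt0// ltr1n.
rewrite lne_EFin// -EFin_max/= ge_max ln3/=.
rewrite mulr_natl -lnXn; last lra.
rewrite ler_ln ?posrE//; last by rewrite exprn_gt0//; lra.
(* Since log 2 is at most 1, log [m] is at most [2 * n * (2 * n + 2)], which is below
   [(3 * n) ^ 2]. *)
apply: (@le_trans _ _ (2 * n * (2 * n + 2))%:R); last first.
  by rewrite -natrM -natrX ler_nat; nia.
apply: (@le_trans _ _ (ln ((2 ^ (2 * n * (2 * n + 2)))%:R : R))).
  by rewrite ler_ln ?posrE ?ltr0n ?expn_gt0// ler_nat.
rewrite natrX lnXn// -[leLHS]mulr_natr -[leRHS]mul1r ler_wpM2r//.
have := @le_ln1Dx R 1; lra.
Qed.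

(** The exponent is chosen so that its successor is exactly [(2 * n + 1) ^ 2]; taking roots of order
    [n + n] and then square roots leaves [2 * n + 1 <= 2 ^ n.+1]. *)
Lemma expn_growth_bound n : (0 < n)%N ->
  ((2 * n * (2 * n + 2)).+1 ^ (n + n) <= 2 ^ (2 * n * (2 * n + 2)))%N.
Proof.
move=> n0; have n2 : (2 * n + 1 <= 2 ^ n.+1)%N.
  by have := ltn_expl n (isT : 1 < 2)%N; rewrite expnS; lia.
have -> : (2 ^ (2 * n * (2 * n + 2)) = ((2 ^ n.+1) ^ 2) ^ (n + n))%N.
  by rewrite -!expnM; congr (_ ^ _)%N; nia.
rewrite leq_exp2r ?addn_gt0 ?n0//.
apply: (@leq_trans ((2 * n + 1) ^ 2)); last by rewrite leq_exp2r.
by rewrite -mulnn; lia.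
Qed.

Lemma info_complexity_r_loglog d (eps : R) : (0 < d)%N -> 0 < eps < 1 ->
  ((3^-1 * expR (8^-1 * eps^-1))%:E <= info_complexity (@r_loglog R d) eps)%E.
Proof.
case: d => [//|d] _ /andP[eps0 eps1].
apply: le_ereal_inf_tmp => _ [n [n0 [Q Qeps]] <-]; rewrite lee_fin.
have n0R : 0 < n%:R :> R by rewrite ltr0n.
set t := (2 * n * (2 * n + 2))%N.
(* If [eps * (2 * ln (3 * n))] is at least 1/4, solving for [n] gives the claim with the constants
   1/3 and 1/8. Otherwise the power inequality is contradicted. *)
have [small|big] := ltP (eps * (2 * ln (3 * n%:R))) 4^-1; last first.
  rewrite ler_pdivrMl// -ler_ln ?posrE ?expR_gt0// ?mulr_gt0//.
  rewrite expRK ler_pdivrMr//; lra.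
have [|||_] := @worst_case_error_expr_le R d n _ Q t eps (2 * ln (3 * n%:R)) _ _ Qeps.
- by rewrite /r_loglog eqxx.
- exact: ltW.
- move=> m /andP[m0 mt]; split; last first.
  + by apply: r_loglog_axis_freq => //; rewrite m0 (leq_trans mt)// expn_growth_bound.
  + exact: r_loglogN.
  + exact: lt_le_trans (r_loglog_ge1 _ _).
(* Weights are at least 1, so [eps] is below 1/4 too. Then [1 - eps] exceeds 1/2, whereas the power
   inequality bounds its [t]-th power by [2 ^+ t * 4^-1 ^+ t]. *)
have epsrho : eps <= eps * (2 * ln (3 * n%:R)).
  rewrite ler_peMr//; first exact: ltW.
  apply: (@le_trans _ _ (r_loglog R (axis_freq d 1))); first exact: r_loglog_ge1.
  by apply: r_loglog_axis_freq; rewrite // expn_gt0.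
rewrite leNgt => /negP[].
apply: (@le_lt_trans _ _ (2 ^+ t * 4^-1 ^+ t)).
  have rho0 : 0 <= eps * (2 * ln (3 * n%:R)) by rewrite (le_trans _ epsrho)// ltW.
  apply: ler_pM; [by []|exact: exprn_ge0| |].
    by rewrite -natrX ler_nat expn_growth_bound.
  by rewrite lerXn2r ?nnegrE// ltW.
rewrite -exprMn ltrXn2r ?nnegrE//; [|lra..].
by rewrite /t -lt0n; nia.
Qed.

End lower_bounds.

(** * Trigonometric polynomials *)

Section cosine_polynomials.
Variable R : realType.
Implicit Types d : nat.

(* The phase [w] makes the class closed under products using real cosines only,
   and the choice [w = - 2 pi k.x] extracts the coefficient at [k]. *)
Definition cosine_poly d (K : 'rV[R]_d -> R) (L : seq (R * 'rV[int]_d)) :=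
  forall x w, K x * cos w =
    \sum_(p <- L) p.1 * cos (2 * pi * dotZ p.2 x + w).

Lemma cosine_poly_cst1 d :
  cosine_poly (fun=> 1) [:: (1 : R, 0 : 'rV[int]_d)].
Proof. by move=> x w; rewrite big_seq1/= dotZ0 mulr0 add0r. Qed.

Lemma cosine_polyM d (K K' : 'rV[R]_d -> R) L L' :
  cosine_poly K L -> cosine_poly K' L' ->
  cosine_poly (fun x => K x * K' x)
    [seq (p.1 * q.1, p.2 + q.2) | p <- L, q <- L'].
Proof.
move=> KL KL' x w; rewrite big_allpairs_dep/=.
rewrite mulrAC KL mulr_suml; apply: eq_bigr => p _.
rewrite mulrAC -mulrA KL' mulr_sumr.
apply: eq_bigr => q _; rewrite mulrA; congr (_ * cos _).
by rewrite addrCA addrA dotZD [in RHS]mulrDr.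
Qed.

Lemma exists_cosine_poly_prod d (I : Type) (s : seq I)
    (K : I -> 'rV[R]_d -> R) :
  (forall i, exists L, cosine_poly (K i) L) ->
  exists L, cosine_poly (fun x => \prod_(i <- s) K i x) L.
Proof.
move=> KL; elim: s => [|i s [L' IHs]].
  exists [:: (1, 0)] => x w; rewrite big_nil; exact: cosine_poly_cst1.
have [L KiL] := KL i; eexists => x w.
by rewrite big_cons; exact: (cosine_polyM KiL IHs).
Qed.

(** The product of the [sin^2 (pi x_j)], written by the half-angle formula so that each factor is
    visibly a combination of cosines. *)
Definition sin_bump d (x : 'rV[R]_d) : R :=
  \prod_(j < d) (2^-1 * (1 - cos (2 * pi * x ord0 j))).

Lemma exists_cosine_poly_bumpX d N :
  exists L, @cosine_poly d (fun x => sin_bump x ^+ N) L.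
Proof.
under eq_exists do under eq_fun do rewrite -[X in _ ^+ X](card_ord N) -prodr_const.
apply: exists_cosine_poly_prod => _; apply: exists_cosine_poly_prod => j.
pose l : 'rV[int]_d := delta_mx ord0 j.
have dl x : dotZ l x = x ord0 j :> R.
  rewrite /dotZ (bigD1 j)//= big1 => [|i ij]; last first.
    by rewrite mxE (negPf ij) andbF mul0r.
  by rewrite mxE !eqxx mul1r addr0.
exists [:: (2^-1, 0); (- 4^-1, l); (- 4^-1, - l)] => x w.
rewrite !big_cons big_nil/= dotZ0 dotZN dl mulr0 add0r mulrN addr0.
set y := 2 * pi * x ord0 j.
have -> : 2^-1 * (1 - cos y) * cos w = 2^-1 * cos w - 2^-1 * (cos y * cos w).
  by rewrite mulrBr mulr1 mulrBl mulrA.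
rewrite cosMcos -[cos (y - w)]cosN opprB [w - y]addrC.
by move: (cos w) (cos (y + w)) (cos (- y + w)) => a b c; lra.
Qed.

Section bound.
Variables (d : nat) (K : 'rV[R]_d -> R) (L : seq (R * 'rV[int]_d)).
Hypotheses (KL : cosine_poly K L) (K0 : forall x, 0 <= K x).
Hypothesis K1 : forall x, K x <= 1.

Let KE x : K x = \sum_(p <- L) p.1 * cos (2 * pi * dotZ p.2 x + 0).
Proof. by rewrite -KL cos0 mulr1. Qed.

Lemma measurable_cosine_poly : measurable_fun setT (K \o @row_of R d).
Proof.
rewrite (_ : K \o _ = fun t =>
  \sum_(p <- L) p.1 * cos (2 * pi * dotZ p.2 (row_of t) + 0)).
  apply: measurable_sum => p; apply: measurable_funM => //.
  exact: measurable_cos_dotZ.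
by apply/funext => t /=; rewrite KE.
Qed.

Lemma cosine_poly_norm x : `|K x| <= 1.
Proof. by rewrite ger0_norm. Qed.

Lemma cosine_poly_integrable : cube_integrable K.
Proof.
exact: bounded_cube_integrable measurable_cosine_poly cosine_poly_norm.
Qed.

(** A frequency may occur several times in [L], so the coefficient at [k] is a sum over its
    occurrences. *)
Lemma cosine_poly_coef (k : 'rV[int]_d) :
  \sum_(p <- L | p.2 == k) p.1 =
  cube_int (fun x => K x * cos (2 * pi * dotZ k x + 0)).
Proof.
rewrite (@eq_cube_int _ _ _ (fun x =>
    \sum_(p <- L) p.1 * cos (2 * pi * dotZ (p.2 - k) x + 0))).
  rewrite cube_int_sum => [|p]; last exact/cube_integrableZl/cube_integrable_cos.
  rewrite big_mkcond; apply: eq_bigr => p _.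
  rewrite cube_intZl; last exact: cube_integrable_cos.
  by rewrite cube_int_cos subr_eq0 cos0; case: ifP; rewrite ?mulr1 ?mulr0.
move=> x; rewrite addr0 -cosN KL; apply: eq_bigr => p _.
by congr (_ * cos _); rewrite addr0 dotZD dotZN mulrBr.
Qed.

Lemma cosine_poly_coef_le (k : 'rV[int]_d) :
  `|\sum_(p <- L | p.2 == k) p.1| <= cube_int K.
Proof.
have iK := cosine_poly_integrable.
have iKc : cube_integrable (fun x => K x * cos (2 * pi * dotZ k x + 0)).
  apply: (cube_integrableMl (M := 1)) => //; first exact: measurable_cos_dotZ.
  by move=> x; exact: cos_max.
rewrite cosine_poly_coef ler_norml; apply/andP; split.
  rewrite -mulN1r -cube_intZl//; apply: le_cube_int => //.
    exact: cube_integrableZl.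
  by move=> x _; rewrite mulN1r -mulrN1 ler_wpM2l// cos_geN1.
by apply: le_cube_int => // x _; rewrite ler_piMr// cos_le1.
Qed.

(** The integral of [f * K] is a finite sum of products [b k * phi k], with [|b k| <= b 0].
    Subtracting [2 * b 0 * phi 0] only flips the sign of the term at zero, so what remains is at
    most [b 0] times a partial sum of the norm of [f]. *)
Lemma wiener_cosine_poly_le (f : 'rV[R]_d -> R) :
  cube_integrable f -> (wnorm (@r_one R d) f <= 1)%E ->
  `|cube_int (fun x => f x * K x) - 2 * cube_int K * cube_int f| <= cube_int K.
Proof.
move=> fi f1.
pose b k := \sum_(p <- L | p.2 == k) p.1.
pose phi k := cube_int (fun x => f x * cos (2 * pi * dotZ k x + 0)).
(* Zero is added by hand so that its term can be isolated even when it is not listed in [L]. *)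
pose U := undup (0 :: map snd L).
have phi_int k : cube_integrable (fun x => f x * cos (2 * pi * dotZ k x + 0)).
  apply: (cube_integrableMl (M := 1)) => //; first exact: measurable_cos_dotZ.
  by move=> x; exact: cos_max.
have phi_le k : `|phi k| <= Normc.normc (fourier f k).
  rewrite /phi -Re_fourier; case: fourier => x y /=.
  by rewrite -sqrtr_sqr ler_wsqrtr// lerDl sqr_ge0.
have sumU : \sum_(k <- U) Normc.normc (fourier f k) <= 1.
  rewrite -lee_fin; apply: le_trans f1; apply: esum_ge.
  exists [set` U]; first by split => //; exact: finite_seq.
  rewrite -fsbig_seq ?undup_uniq// sumEFin lee_fin.
  by apply: ler_sum => k _; rewrite mulr1.
have fKE : cube_int (fun x => f x * K x) = \sum_(k <- U) b k * phi k.
  rewrite (@eq_cube_int _ _ _ (fun x =>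
      \sum_(p <- L) p.1 * (f x * cos (2 * pi * dotZ p.2 x + 0)))); last first.
    by move=> x; rewrite KE mulr_sumr; apply: eq_bigr => p _; rewrite mulrCA.
  rewrite cube_int_sum => [|p]; last exact: cube_integrableZl.
  under [RHS]eq_bigr => k _ do rewrite mulr_suml big_mkcond.
  rewrite exchange_big/= big_seq [RHS]big_seq; apply: eq_bigr => p pL.
  have pU : p.2 \in U by rewrite mem_undup inE map_f ?orbT.
  rewrite (bigD1_seq _ pU (undup_uniq _))/= eqxx cube_intZl//.
  by rewrite big1 ?addr0// => k kp; rewrite eq_sym (negPf kp).
have b0 : b 0 = cube_int K.
  rewrite /b cosine_poly_coef; apply: eq_cube_int => x.
  by rewrite dotZ0 mulr0 addr0 cos0 mulr1.
have phi0 : phi 0 = cube_int f.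
  by apply: eq_cube_int => x; rewrite dotZ0 mulr0 addr0 cos0 mulr1.
have K_ge0 : 0 <= cube_int K by apply: Rintegral_ge0 => t _; exact: K0.
have U0 : 0 \in U by rewrite mem_undup inE eqxx.
rewrite -[leRHS]mulr1; apply: le_trans (ler_wpM2l K_ge0 sumU).
rewrite fKE -b0 -phi0 !(bigD1_seq 0 U0 (undup_uniq _))/= addrAC.
rewrite mulrDr b0; apply: le_trans (ler_normD _ _) _; apply: lerD.
  have -> : cube_int K * phi 0 - 2 * cube_int K * phi 0 = - (cube_int K * phi 0).
    by ring.
  by rewrite normrN normrM ger0_norm// ler_wpM2l.
apply: le_trans (ler_norm_sum _ _ _) _; rewrite mulr_sumr; apply: ler_sum => k _.
by rewrite normrM ler_pM// cosine_poly_coef_le.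
Qed.

End bound.
End cosine_polynomials.

(** * Concentration at the centre of the cube *)

Section concentration.
Variable R : realType.
Local Notation mu d := (lebesgue_tuple R d).
Local Notation tcube d := (@row_of R d @^-1` @cube R d).

(** This is [cos^2 (pi s)]: the factor of [sin_bump] contributed by a coordinate at distance [s]
    from 1/2. *)
Definition profile (s : R) : R := 2^-1 * (1 + cos (2 * pi * s)).

Lemma mulr2pi_itv (s : R) : 0 <= s -> s <= 2^-1 -> 2 * pi * s \in `[0, (pi : R)].
Proof.
move=> s0 s2; rewrite in_itv/= !mulr_ge0 ?pi_ge0//=.
by rewrite -[leRHS]mulr1 (mulrC 2) -mulrA ler_pM2l ?pi_gt0//; lra.
Qed.

Lemma profile_anti (s s' : R) : 0 <= s -> s <= s' -> s' <= 2^-1 ->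
  profile s' <= profile s.
Proof.
move=> s0 ss' s'2; rewrite ler_wpM2l// lerD2l leNgt.
rewrite ltr_cos; [|by apply: mulr2pi_itv; lra..].
by rewrite ltr_pM2l ?mulr_gt0 ?pi_gt0// -leNgt.
Qed.

Lemma profile0 : profile 0 = 1.
Proof. by rewrite /profile mulr0 cos0; lra. Qed.

Lemma profile_lt1 (s : R) : 0 < s -> s <= 2^-1 -> profile s < 1.
Proof.
move=> s0 s2; suff : cos (2 * pi * s) < 1 by rewrite /profile; lra.
rewrite -[ltRHS]cos0 -[in ltRHS](mulr0 (2 * pi)).
rewrite ltr_cos; [|by apply: mulr2pi_itv; lra..].
by rewrite ltr_pM2l ?mulr_gt0 ?pi_gt0.
Qed.

Lemma profile_ge0 (s : R) : 0 <= profile s.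
Proof. by rewrite mulr_ge0// -lerBlDl sub0r cos_geN1. Qed.

Lemma profile_le1 (s : R) : profile s <= 1.
Proof. by have := cos_le1 (2 * pi * s); rewrite /profile; lra. Qed.

Lemma profile_half : 2^-1 <= profile 4^-1.
Proof.
rewrite /profile (_ : 2 * pi * 4^-1 = pi / 2); first by rewrite cos_pihalf; lra.
by move: (pi : R) => p; lra.
Qed.

Lemma profile_continuous : continuous profile.
Proof.
move=> s; apply: cvgM; first exact: cvg_cst.
apply: cvgD; first exact: cvg_cst.
have /(_ s) := @continuous_cos_comp R R 1 (2 * pi) id (fun x => cvg_id).
by under [X in continuous_at _ X]eq_fun do rewrite mul1r.
Qed.

Lemma sin_bumpE d (x : 'rV[R]_d) : sin_bump x = \prod_j profile `|x ord0 j - 2^-1|.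
Proof.
apply: eq_bigr => j _; set y := x ord0 j; rewrite /profile; congr (_ * (1 + _)).
have pi0 : 0 <= 2 * pi :> R by rewrite mulr_ge0// pi_ge0.
rewrite -{2}(ger0_norm pi0) -normrM cos_norm.
rewrite (_ : 2 * pi * y = 2 * pi * (y - 2^-1) + pi) ?cosDpi ?opprK//.
by move: (pi : R) => p; lra.
Qed.

Lemma bump_ge0 d (x : 'rV[R]_d) : 0 <= sin_bump x.
Proof. by rewrite sin_bumpE prodr_ge0// => j _; exact: profile_ge0. Qed.

Lemma bump_le1 d (x : 'rV[R]_d) : sin_bump x <= 1.
Proof. by rewrite sin_bumpE prodr_ile1// => j _; rewrite profile_ge0 profile_le1. Qed.

Lemma bump_far d (s : R) (x : 'rV[R]_d) : 0 <= s -> cube x ->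
  (exists j, s <= `|x ord0 j - 2^-1|) -> sin_bump x <= profile s.
Proof.
move=> s0 xc [j sj]; rewrite sin_bumpE (bigD1 j)//=.
apply: (@le_trans _ _ (profile `|x ord0 j - 2^-1| * 1)).
  rewrite ler_wpM2l ?profile_ge0// prodr_ile1// => i _.
  by rewrite profile_ge0 profile_le1.
rewrite mulr1; apply: profile_anti => //.
by have /andP[] := xc j; rewrite ler_norml; lra.
Qed.

Lemma bump_near d (s : R) (x : 'rV[R]_d) : s <= 2^-1 ->
  (forall j, `|x ord0 j - 2^-1| <= s) -> profile s ^+ d <= sin_bump x.
Proof.
move=> s2 xs; rewrite sin_bumpE -[X in _ ^+ X](card_ord d) -prodr_const.
apply: ler_prod => j _; rewrite profile_ge0/=.
exact: profile_anti.
Qed.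

(** [profile] is continuous with value 1 at 0. With [q] the bound on the bump away from the centre,
    this yields a small box where the bump stays strictly above [q]. *)
Lemma exists_profileX_gt d (q : R) : q < 1 ->
  exists s, [/\ 0 < s, s <= 4^-1 & q < profile s ^+ d].
Proof.
move=> q1.
have : (fun s => profile s ^+ d) s @[s --> (0 : R)] --> profile 0 ^+ d.
  apply: (@continuous_comp _ _ _ profile (fun y => y ^+ d)).
    exact: profile_continuous.
  exact: exprn_continuous.
rewrite profile0 expr1n => /cvgrPdist_lt/(_ (1 - q)).
rewrite subr_gt0 => /(_ q1)/nbhs_ballP[e /= e0 he].
exists (Num.min (e / 2) 4^-1); split.
- by rewrite lt_min divr_gt0//=; lra.
- by rewrite ge_min lexx orbT.
have := he (Num.min (e / 2) 4^-1).
rewrite /ball/= sub0r normrN gtr0_norm ?lt_min ?divr_gt0 ?invr_gt0 ?ltr0n//.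
rewrite gt_min ltr_pdivrMr// ltr_pMr// ltr1n => /(_ isT).
by move/(le_lt_trans (ler_norm _)); lra.
Qed.

(** Take for [v] the volume of the box of half-side [s] around the centre, which lies in the cube
    and does not depend on [N]; the bump is at least [profile s ^+ d] there. *)
Lemma cube_int_bumpX_gt d (s : R) : 0 < s -> s <= 4^-1 ->
  exists2 v : R, 0 < v &
    forall N, (profile s ^+ d) ^+ N * v <= cube_int (fun x : 'rV[R]_d => sin_bump x ^+ N).
Proof.
move=> s0 s4.
pose A (i : 'I_d) : set (measurableTypeR R) := `]2^-1 - s, 2^-1 + s[%classic.
pose B := [set t : d.-tuple (measurableTypeR R) | forall i, A i (tnth t i)].
have mB : measurable B by apply: measurable_tnth_set => i; exact: measurable_itv.
have muB : mu d B = ((s *+ 2) ^+ d)%:E.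
  rewrite lebesgue_tuple_box; last by move=> i; exact: measurable_itv.
  rewrite (eq_bigr (fun=> (s *+ 2)%:E)) => [|i _].
    by rewrite prodEFin prodr_const card_ord.
  rewrite /= lebesgue_measure_itv/= lte_fin ifT; last by lra.
  by congr (_%:E); lra.
exists ((s *+ 2) ^+ d) => [|N]; first by rewrite exprn_gt0// mulrn_wgt0.
have [L KL] := exists_cosine_poly_bumpX R d N.
have K0 (x : 'rV[R]_d) : 0 <= sin_bump x ^+ N by rewrite exprn_ge0// bump_ge0.
have K1 (x : 'rV[R]_d) : sin_bump x ^+ N <= 1 by rewrite exprn_ile1 ?bump_ge0 ?bump_le1.
have iK := cosine_poly_integrable KL K0 K1.
have mK := measurable_cosine_poly KL.
move/measurable_EFinP in mK.
rewrite -lee_fin fineK; last exact: (integrable_fin_num (@measurable_tcube R d) iK).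
rewrite EFinM -muB -integral_cst//.
apply: (@le_trans _ _ (\int[mu d]_(t in B) (sin_bump (row_of t) ^+ N)%:E)%E).
  apply: ge0_le_integral => //.
  - by move=> t _; rewrite lee_fin !exprn_ge0// profile_ge0.
  - exact: measurable_funTS.
  - move=> t Bt; rewrite lee_fin lerXn2r ?nnegrE ?exprn_ge0 ?profile_ge0 ?bump_ge0//.
    apply: bump_near => [|j]; first lra.
    by rewrite mxE; have := Bt j; rewrite /A/= in_itv/= ler_norml; lra.
apply: ge0_subset_integral => //.
- exact: measurable_tcube.
- exact: measurable_funTS.
- by move=> t _; rewrite lee_fin.
- by move=> t Bt j; rewrite mxE; have := Bt j; rewrite /A/= in_itv/=; lra.
Qed.

End concentration.

(** * Upper bound *)

Section upper_bound.
Variable R : realType.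
Local Notation center d := (const_mx 2^-1 : 'rV[R]_d).

Lemma cube_center d : cube (center d).
Proof. by move=> j; rewrite mxE; lra. Qed.

Lemma within_cube_continuous_center d (f : 'rV[R]_d -> R) (e : R) :
  {within @cube R d, continuous f} -> 0 < e ->
  exists s, [/\ 0 < s, s <= 4^-1 & forall x, cube x ->
    (forall j, `|x ord0 j - 2^-1| < s) -> `|f x - f (center d)| < e].
Proof.
move=> /subspace_continuousP/(_ _ (@cube_center d)) cf e0.
move/cvgrPdist_lt/(_ _ e0)/nbhs_ballP : cf => [s /= s0 sf].
exists (Num.min s 4^-1); split; first by rewrite lt_min s0/= invr_gt0 ltr0n.
  by rewrite ge_min lexx orbT.
move=> x xc xs; rewrite distrC; apply: sf => //; split => // i j.
rewrite ord1 mxE /ball/= distrC; apply: lt_le_trans (xs j) _.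
by rewrite ge_min lexx.
Qed.

Lemma exists_expr_lt (x C : R) : 0 <= x -> x < 1 -> 0 < C -> exists N, x ^+ N < C.
Proof.
move=> x0 x1 C0; have := @cvg_expr R x; rewrite ger0_norm// => /(_ x1).
move/cvgrPdist_lt/(_ _ C0) => [N _ /(_ N (leqnn N))] /=.
by rewrite sub0r normrN ger0_norm ?exprn_ge0//; exists N.
Qed.

(** Two scales are compared. Outside the [s]-neighbourhood where [f] is nearly constant, the bump is
    at most [q]; on a smaller box it is at least some [p > q]. The far part thus costs [q ^+ N]
    against a total mass of at least [p ^+ N * v]. As [f] may be unbounded, the far part is measured
    by the integral [M] of [|f - f(center)|]. *)
Lemma sin_bump_concentration d (f : 'rV[R]_d -> R) (e : R) :
  cube_integrable f -> {within @cube R d, continuous f} -> 0 < e ->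
  exists N, 0 < cube_int (fun x : 'rV[R]_d => sin_bump x ^+ N) /\
    `|cube_int (fun x => f x * sin_bump x ^+ N)
      - f (center d) * cube_int (fun x : 'rV[R]_d => sin_bump x ^+ N)|
    <= e * cube_int (fun x : 'rV[R]_d => sin_bump x ^+ N).
Proof.
move=> fi fc e0.
have [s [s0 s4 fs]] := within_cube_continuous_center fc (divr_gt0 e0 (ltr0n _ 2)).
pose q := profile s.
have q0 : 0 < q.
  by apply: lt_le_trans (le_trans (profile_half R) (profile_anti _ s4 _)); lra.
have q1 : q < 1 by apply: profile_lt1 => //; lra.
have [s' [s'0 s'4 qp]] := exists_profileX_gt d q1.
have [v v0 vN] := cube_int_bumpX_gt d s'0 s'4.
set p := profile s' ^+ d in qp vN; clearbody p.
have p0 : 0 < p by exact: lt_trans qp.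
pose g x : R := `|f x - f (center d)|.
have fBi : cube_integrable (fun x => f x - f (center d)).
  apply: cube_integrableB => //.
  apply: (@bounded_cube_integrable R d (fun=> f (center d)) `|f (center d)|) => //.
  exact: measurable_cst.
have gi : cube_integrable g by exact: cube_integrable_norm fBi.
pose M := cube_int g.
have M0 : 0 <= M by apply: Rintegral_ge0 => t _; exact: normr_ge0.
(* The denominator is [M + 1] because [M] may vanish. *)
have [N qpN] : exists N, (q / p) ^+ N < e / 2 * v / (M + 1).
  apply: exists_expr_lt.
  - by rewrite divr_ge0// ltW.
  - by rewrite ltr_pdivrMr// mul1r.
  - by rewrite !(mulr_gt0, invr_gt0)//; lra.
exists N.
have [L KL] := exists_cosine_poly_bumpX R d N.
have K0 (x : 'rV[R]_d) : 0 <= sin_bump x ^+ N by rewrite exprn_ge0// bump_ge0.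
have K1 (x : 'rV[R]_d) : sin_bump x ^+ N <= 1.
  by rewrite exprn_ile1 ?bump_ge0 ?bump_le1.
have iK := cosine_poly_integrable KL K0 K1.
have mK := measurable_cosine_poly KL.
set J := cube_int _.
have pvJ : p ^+ N * v <= J by exact: vN.
have iMK (h : 'rV[R]_d -> R) : cube_integrable h ->
    cube_integrable (fun x => h x * sin_bump x ^+ N).
  by move=> hi; exact: cube_integrableMl hi mK (cosine_poly_norm K0 K1).
split; first by apply: lt_le_trans pvJ; rewrite mulr_gt0// exprn_gt0.
have qM : q ^+ N * M <= e / 2 * J.
  apply: (@le_trans _ _ (e / 2 * (p ^+ N * v))); last by rewrite ler_wpM2l//; lra.
  have : q ^+ N * (M + 1) <= e / 2 * v * p ^+ N.
    rewrite -ler_pdivrMr ?exprn_gt0// mulrAC -expr_div_n.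
    by rewrite -ler_pdivlMr ?ltr_wpDl// ltW.
  rewrite mulrA [e / 2 * _ * v]mulrAC; apply: le_trans.
  by rewrite ler_wpM2l ?exprn_ge0 ?(ltW q0)// lerDl.
rewrite -cube_intZl// -cube_intB//; [|exact: iMK|exact: cube_integrableZl].
rewrite (@eq_cube_int _ _ _ (fun x => (f x - f (center d)) * sin_bump x ^+ N));
  last by move=> x; rewrite mulrBl.
apply: le_trans (le_norm_cube_int (iMK _ fBi)) _.
apply: (@le_trans _ _ (cube_int (fun x => e / 2 * sin_bump x ^+ N + q ^+ N * g x))).
  apply: le_cube_int.
  - exact: cube_integrable_norm (iMK _ fBi).
  - by apply: cube_integrableD; exact: cube_integrableZl.
  move=> x xc; rewrite normrM (ger0_norm (K0 x)) -/(g x).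
  have g0 : 0 <= g x by exact: normr_ge0.
  have [near|/existsNP[j /negP]] :=
      pselect (forall j, `|x ord0 j - 2^-1| < s).
    rewrite -[leLHS]addr0 lerD ?mulr_ge0 ?exprn_ge0 ?(ltW q0)//.
    by rewrite ler_wpM2r// ltW// fs.
  rewrite -leNgt => far.
  rewrite -[leLHS]add0r lerD ?mulr_ge0//; first by lra.
  rewrite mulrC ler_wpM2r// lerXn2r ?nnegrE ?bump_ge0 ?(ltW q0)//.
  by apply: bump_far => //; [exact: ltW|exists j].
rewrite cube_intD; [|exact: cube_integrableZl..].
rewrite !cube_intZl// -/J -/M; lra.
Qed.

(** With [J] the mass of a concentrated bump, the coefficient bound and the concentration bound
    together give [|f(center) - 2 I(f)| * J <= J + e * J]; dividing by [J] and letting [e] tend to 0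
    gives the claim. *)
Lemma wiener_r_one_center d (f : 'rV[R]_d -> R) :
  wiener (@r_one R d) f -> (wnorm (@r_one R d) f <= 1)%E ->
  `|cube_int f - f (center d) / 2| <= 1 / 2.
Proof.
move=> [fc fi _] f1.
suff : `|f (center d) - 2 * cube_int f| <= 1.
  rewrite (_ : cube_int f - _ = - 2^-1 * (f (center d) - 2 * cube_int f)); last first.
    by lra.
  by move=> ?; rewrite normrM normrN [`|2^-1|]gtr0_norm ?invr_gt0 ?ltr0n//; lra.
apply/ler_addgt0Pr => e e0.
have [N [J0 concN]] := sin_bump_concentration fi fc e0.
have [L KL] := exists_cosine_poly_bumpX R d N.
have K0 (x : 'rV[R]_d) : 0 <= sin_bump x ^+ N by rewrite exprn_ge0// bump_ge0.
have K1 (x : 'rV[R]_d) : sin_bump x ^+ N <= 1.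
  by rewrite exprn_ile1 ?bump_ge0 ?bump_le1.
have wN := wiener_cosine_poly_le KL K0 K1 fi f1.
set J := cube_int _ in J0 concN wN; set I := cube_int _ in concN wN.
rewrite -(ler_pM2r J0) [leRHS]mulrDl mul1r.
have -> : `|f (center d) - 2 * cube_int f| * J =
    `|(I - 2 * J * cube_int f) - (I - f (center d) * J)|.
  by rewrite -{1}(gtr0_norm J0) -normrM; congr `|_|; ring.
by apply: le_trans (ler_normB _ _) _; exact: lerD.
Qed.

(** All [n] points coincide at the centre and the weights add up to 1/2, so the one-point formula is
    available for every positive [n]. *)
Definition center_algorithm d n : algorithm R d n :=
  Algorithm (fun _ : 'I_n => (2 * n%:R)^-1) (fun=> @cube_center d).

Lemma worst_case_error_center d n : (0 < n)%N ->
  (worst_case_error (@r_one R d) (center_algorithm d n) <= (1 / 2)%:E)%E.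
Proof.
move=> n0; apply: ge_ereal_sup => _ [f [fw f1] <-]; rewrite lee_fin.
have -> : apply_alg (center_algorithm d n) f = f (center d) / 2.
  rewrite /apply_alg/= sumr_const card_ord -[LHS]mulr_natr.
  by field; rewrite pnatr_eq0 -lt0n.
exact: wiener_r_one_center.
Qed.

End upper_bound.

Theorem theorem1 (R : realType) :
  [/\ forall n d : nat, (0 < n)%N -> (0 < d)%N ->
        ereal_inf [set worst_case_error (@r_one R d) Q
                  | Q in [set: algorithm R d n]] = (1 / 2)%:E,
      forall (d : nat) (eps : R), (0 < d)%N -> 0 < eps < 1 / 2 ->
        info_complexity (@r_one R d) eps = +oo%E
    & exists c a : R, [/\ 0 < c, 0 < a &
        forall (d : nat) (eps : R), (0 < d)%N -> 0 < eps < 1 ->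
          ((c * expR (a * eps^-1))%:E
             <= info_complexity (@r_loglog R d) eps)%E]].
Proof.
split.
- move=> n [//|d] n0 _; apply/eqP; rewrite eq_le; apply/andP; split.
    apply: le_trans _ (worst_case_error_center R d.+1 n0).
    by apply: ereal_inf_lbound; exists (center_algorithm R d.+1 n).
  by apply: le_ereal_inf_tmp => _ [Q _ <-]; exact: half_le_worst_case_error.
- by move=> d eps; exact: info_complexity_r_one.
- exists 3^-1, 8^-1; split; rewrite ?invr_gt0 ?ltr0n//.
  by move=> d eps; exact: info_complexity_r_loglog.
Qed.
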